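(* Let $A$ be an algebra over $\mathbb{C}$, and let $\{\|\cdot\|_\alpha\}_{\alpha\in\Lambda}$ be a family of seminorms on $A$. Suppose that ${}^{*}$ and ${}^{\#}$ are two involutions on $A$ such that $(A,{}^{*},\{\|\cdot\|_\alpha\}_{\alpha\in\Lambda})$ and $(A,{}^{\#},\{\|\cdot\|_\alpha\}_{\alpha\in\Lambda})$ are both locally $C^{*}$-algebras (with the same underlying algebra and the same family of seminorms); in particular, each seminorm $\|\cdot\|_\alpha$, $\alpha\in\Lambda$, satisfies the $C^{*}$-condition for both operations, i.e. $\|a^{*}a\|_\alpha=\|a\|_\alpha^{2}$ and $\|a^{\#}a\|_\alpha=\|a\|_\alpha^{2}$ for all $a\in A$ and $\alpha\in\Lambda$. Then ${}^{*}={}^{\#}$ on $A$, i.e. $a^{*}=a^{\#}$ for every $a\in A$.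
   Context: Algebras are associative algebras over $\mathbb{C}$ (not assumed unital or commutative). An involution on an algebra $A$ is a map ${}^{*}:A\to A$ with $(a^{*})^{*}=a$, $(a+\lambda b)^{*}=a^{*}+\overline{\lambda}\,b^{*}$ and $(ab)^{*}=b^{*}a^{*}$ for all $a,b\in A$, $\lambda\in\mathbb{C}$; an algebra with an involution is a $^{*}$-algebra. A topological $^{*}$-algebra is a $^{*}$-algebra with a topology making addition, multiplication, additive inverse and involution jointly continuous. A seminorm $\|\cdot\|$ on a $^{*}$-algebra $A$ is a $C^{*}$-seminorm if it is submultiplicative, $\|ab\|\le\|a\|\,\|b\|$, and satisfies the $C^{*}$-condition $\|a^{*}a\|=\|a\|^{2}$, for all $a,b\in A$. A locally $C^{*}$-algebra is a topological $^{*}$-algebra that is topologically $^{*}$-isomorphic to a Hausdorff projective limit of a projective family of $C^{*}$-algebras (indexed by a directed set, with continuous $^{*}$-homomorphisms as connecting maps); equivalently, it is a complete Hausdorff topological $^{*}$-algebra whose topology is generated by a saturated separating family of $C^{*}$-seminorms. Here ''separating'' means that $\|a\|_\alpha=0$ for all $\alpha$ implies $a=0$, and ''saturated'' means that the maximum of any finitely many members of the family is again in the family. The notation $(A,{}^{*},\{\|\cdot\|_\alpha\}_{\alpha\in\Lambda})$ is a locally $C^{*}$-algebra means: $A$ with the involution ${}^{*}$ and the topology generated by the seminorms $\|\cdot\|_\alpha$, $\alpha\in\Lambda$, is a complete Hausdorff topological $^{*}$-algebra, and $\{\|\cdot\|_\alpha\}_{\alpha\in\Lambda}$ is a saturated separating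 family of $C^{*}$-seminorms with respect to ${}^{*}$. The same applies with ${}^{\#}$ in place of ${}^{*}$. *)

(* Defs.v *)
From HB Require Import structures.
From mathcomp Require Import all_boot all_order all_algebra.
From mathcomp Require Import complex.
From mathcomp Require Import all_classical all_reals all_analysis.

Set Implicit Arguments.
Unset Strict Implicit.
Unset Printing Implicit Defensive.

Import Order.TTheory GRing.Theory Num.Theory.

Local Open Scope classical_set_scope.
Local Open Scope ring_scope.
Local Open Scope complex_scope.

(* Algebras are not assumed unital, so they are not GRing algebras: an algebra *)
(* over the complex numbers R[i] is an lmodType R[i] with an associative       *)
(* bilinear operation mul.                                                    *)

Record seminorm (R : realType) (A : lmodType R[i]) := Seminorm {
  seminorm_fun :> A -> R;
  seminorm_ge0 : forall a, 0 <= seminorm_fun a;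
  seminormD : forall a b,
    seminorm_fun (a + b) <= seminorm_fun a + seminorm_fun b;
  seminormZ : forall (l : R[i]) a,
    seminorm_fun (l *: a) = ComplexField.Normc.normc l * seminorm_fun a }.

(* Alias of A carrying the topology, in fact the uniform structure, generated *)
(* by the family p: its basic entourages are                                  *)
(*   {(x, y) | p i (x - y) < e for all i in F},  F : set L finite, e > 0.     *)
Definition seminorm_space (R : realType) (A : lmodType R[i]) (L : Type)
  (p : L -> seminorm A) : Type := A.

Section SeminormSpace.
Context (R : realType) (A : lmodType R[i]) (L : Type) (p : L -> seminorm A).

Local Notation T := (seminorm_space p).

HB.instance Definition _ := GRing.Lmodule.on T.
HB.instance Definition _ := isPointed.Build T 0.

Definition seminorm_ent : set_system (T * T) :=
  filter_from [set Fe : set L * R | finite_set Fe.1 /\ 0 < Fe.2]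
    (fun Fe => [set xy | forall i, Fe.1 i -> p i (xy.1 - xy.2) < Fe.2]).

Let seminorm0 (q : seminorm A) : q 0 = 0.
Proof. by rewrite -(scale0r (0 : A)) seminormZ ComplexField.Normc.normc0 mul0r. Qed.

Let seminormN (q : seminorm A) a : q (- a) = q a.
Proof.
rewrite -scaleN1r seminormZ /ComplexField.Normc.normc /= oppr0.
by rewrite sqrrN expr1n expr0n addr0 sqrtr1 mul1r.
Qed.

Let seminorm_ent_filter : Filter seminorm_ent.
Proof.
apply: filter_from_filter; first by exists (set0, 1); split => //=.
move=> [F e] [G d] /= [finF e0] [finG d0].
exists (F `|` G, Num.min e d) => /=.
  by split; [rewrite finite_setU | rewrite lt_min e0].
move=> -[x y] /= h; split=> /= i Fi.
  by have := h i (or_introl Fi); rewrite lt_min => /andP[].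
by have := h i (or_intror Fi); rewrite lt_min => /andP[].
Qed.

Local Open Scope relation_scope.

Let seminorm_ent_diagonal (E : set (T * T)) :
  seminorm_ent E -> diagonal `<=` E.
Proof.
move=> [[F e] /= [_ e0] FE] [x y] /= xy; apply: FE => i _ /=.
by rewrite (_ : x = y)// subrr seminorm0.
Qed.

Let seminorm_ent_inv (E : set (T * T)) :
  seminorm_ent E -> seminorm_ent E^-1.
Proof.
move=> [[F e] /= Fe FE]; exists (F, e) => //= -[x y] /= h.
by apply: FE => i Fi /=; rewrite -seminormN opprB; exact: h.
Qed.

Let seminorm_ent_split (E : set (T * T)) :
  seminorm_ent E -> exists2 D, seminorm_ent D & D \; D `<=` E.
Proof.
move=> [[F e] /= [finF e0] FE].
exists [set xy | forall i, F i -> p i (xy.1 - xy.2) < e / 2].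
  by exists (F, e / 2) => //=; split => //; rewrite divr_gt0.
move=> [x z] /= [y /= xy yz]; apply: FE => i Fi /=.
rewrite -(subrKA y) (splitr e); apply: (le_lt_trans (seminormD _ _ _)).
by rewrite ltrD// ?xy ?yz.
Qed.

HB.instance Definition _ := isUniform.Build T
  seminorm_ent_filter seminorm_ent_diagonal seminorm_ent_inv seminorm_ent_split.

End SeminormSpace.

Section LocallyCstar.
Context (R : realType).

Record is_involution (A : lmodType R[i]) (mul : A -> A -> A) (star : A -> A) :
  Prop := {
  involutionK : forall a, star (star a) = a;
  involution_antilinear : forall a b (l : R[i]),
    star (a + l *: b) = star a + conjc l *: star b;
  involutionM : forall a b, star (mul a b) = mul (star b) (star a) }.

(* Continuity of the scaling by R[i] is not part of the definition. *)
Record is_topological_star_algebra (T : preTopologicalLmodType R[i])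
    (mul : T -> T -> T) (star : T -> T) : Prop := {
  star_algebra_involution : is_involution mul star;
  star_algebra_add_continuous : continuous (fun xy : T * T => xy.1 + xy.2);
  star_algebra_mul_continuous : continuous (fun xy : T * T => mul xy.1 xy.2);
  star_algebra_opp_continuous : continuous (fun x : T => - x);
  star_algebra_star_continuous : continuous star }.

(* The axiom of completeType, as a predicate. *)
Definition complete_space (T : puniformType) : Prop :=
  forall F : set_system T, ProperFilter F -> cauchy F -> cvg F.

Record is_Cstar_seminorm (A : lmodType R[i]) (mul : A -> A -> A)
    (star : A -> A) (q : A -> R) : Prop := {
  Cstar_seminormM : forall a b, q (mul a b) <= q a * q b;
  Cstar_identity : forall a, q (mul (star a) a) = q a ^+ 2 }.

Definition separating (A : lmodType R[i]) (L : Type) (p : L -> seminorm A) :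
  Prop := forall a, (forall i, p i a = 0) -> a = 0.

(* The members considered are p i and the p k with k in s, i.e. any nonempty *)
(* finite list of members.                                                   *)
Definition saturated (A : lmodType R[i]) (L : Type) (p : L -> seminorm A) :
  Prop := forall (i : L) (s : seq L), exists j : L,
    forall a, p j a = \big[Num.max/p i a]_(k <- s) p k a.

Record is_locally_Cstar (A : lmodType R[i]) (mul : A -> A -> A)
    (star : A -> A) (L : Type) (p : L -> seminorm A) : Prop := {
  locally_Cstar_topological :
    @is_topological_star_algebra (seminorm_space p) mul star;
  locally_Cstar_hausdorff : hausdorff_space (seminorm_space p);
  locally_Cstar_complete : complete_space (seminorm_space p);
  locally_Cstar_seminorm : forall i, is_Cstar_seminorm mul star (p i);
  locally_Cstar_separating : separating p;
  locally_Cstar_saturated : saturated p }.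

End LocallyCstar.

(* Main.v *)
Require Import Defs.
From mathcomp Require Import all_boot all_order all_algebra.
From mathcomp Require Import complex.
From mathcomp Require Import all_classical all_reals all_analysis.
From mathcomp Require Import cyclic separable cyclotomic ring lra.

Import Order.TTheory GRing.Theory Num.Theory.

Local Open Scope ring_scope.
Local Open Scope complex_scope.

(** A C*-seminorm remembers which elements are skew-adjoint, whatever the
    involution.  In a unital C*-algebra, u is skew-adjoint exactly when
    [|1 + t u|] is [1 + O(t^2)] for real t: one direction is
    [|1 + t u|^2 = |(1 - t u) (1 + t u)| = |1 - t^2 u^2|], and this condition
    no longer mentions the involution.

    Algebras here have no unit, so 1 + w is replaced by the operator
    [b |-> b + w b], whose growth is controlled by applying the C*-identity of q
    to the vector [b + w b] ([skew_shift_le]).  Let u be skew for one involution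
    [star], and let [v := u + sharp u], twice the real part of u for the other
    one.  The real part of [b^# (b + 4 u b)] is [b^# (b + 2 v b)]; hence the
    bound on the shifts by real multiples of u passes to those by real multiples
    of v ([sharp_real_part_shift_le]).  The shifts by imaginary multiples of v
    are bounded because i v is skew for [sharp].  Averaging the two directions,
    [q (b + z v b) <= (1 + C |z|^2) q b] for every complex z.

    Such a bound forces left multiplication by v to vanish for q
    ([shift_growth_eq0]): the N-th iterate of the shift by z is a polynomial in z
    with linear coefficient [N v b], so the Cauchy estimate on the circle of
    radius [1/m] with [N = m^2] gives [m q (v b) <= (1 + C/m^2)^(m^2) q b], whose
    right-hand side is at most [e^C q b].  Since v is self-adjoint for [sharp],
    [q v ^ 2 = q (v v) = 0].

    When the seminorms separate points, v = 0, so every [star]-skew element is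
    [sharp]-skew; as each element is the sum of a skew element and i times
    another one, the involutions agree.  All of this takes place in A itself, with
    one seminorm at a time. *)

(** * Seminorms over the complex numbers *)

Local Notation normc := ComplexField.Normc.normc.

Lemma normc_ge0 {R : rcfType} (z : R[i]) : 0 <= normc z.
Proof. by case: z => x y; exact: sqrtr_ge0. Qed.

Lemma normcX {R : rcfType} (z : R[i]) n : normc (z ^+ n) = normc z ^+ n.
Proof.
elim: n => [|n IHn]; first by rewrite !expr0 ComplexField.Normc.normc1.
by rewrite !exprS ComplexField.Normc.normcM IHn.
Qed.

Lemma normc_real {R : rcfType} (x : R) : normc x%:C = `|x|.
Proof. by rewrite /= expr0n addr0 sqrtr_sqr. Qed.

Lemma normc_imaginary {R : rcfType} (y : R) : normc (0 +i* y) = `|y|.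
Proof. by rewrite /= expr0n add0r sqrtr_sqr. Qed.

Lemma seminormN {R : realType} {A : lmodType R[i]} (q : seminorm A) a :
  q (- a) = q a.
Proof. by rewrite -scaleN1r seminormZ normcN ComplexField.Normc.normc1 mul1r. Qed.

Lemma seminorm0 {R : realType} {A : lmodType R[i]} (q : seminorm A) : q 0 = 0.
Proof. by rewrite -(scale0r 0) seminormZ ComplexField.Normc.normc0 mul0r. Qed.

Lemma seminormZ_nat {R : realType} {A : lmodType R[i]} (q : seminorm A) n a :
  q (n%:R *: a) = n%:R * q a.
Proof.
by rewrite seminormZ -(@rmorph_nat _ _ (real_complex R)) normc_real ger0_norm.
Qed.

Lemma seminorm_sum {R : realType} {A : lmodType R[i]} (q : seminorm A)
    n (F : nat -> A) :
  q (\sum_(k < n) F k) <= \sum_(k < n) q (F k).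
Proof.
elim: n => [|n IHn]; first by rewrite !big_ord0 seminorm0.
rewrite !big_ord_recr /=; apply: le_trans (seminormD _ _ _) _.
by rewrite lerD2r.
Qed.

(** * Cauchy estimates for vector-valued polynomials *)

Lemma prim_root_exists (F : numClosedFieldType) {n} :
  (0 < n)%N -> exists w : F, n.-primitive_root w.
Proof.
move=> n_gt0; have [r] := closed_field_poly_normal ('X^n - 1 : {poly F}).
rewrite (monicP (monicXnsubC 1 n_gt0)) scale1r => Xn1E.
have r_roots : all n.-unity_root r.
  by apply/allP => z; rewrite -root_prod_XsubC -Xn1E.
have r_uniq : uniq r.
  by rewrite -separable_prod_XsubC -Xn1E separable_Xn_sub_1// pnatr_eq0 -lt0n.
have r_size : (n <= size r)%N.
  by rewrite -ltnS -(size_prod_XsubC r id) -Xn1E size_XnsubC.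
by have /hasP[w _ ?] := has_prim_root n_gt0 r_roots r_uniq r_size; exists w.
Qed.

(** Orthogonality of the characters of the cyclic group of order n, as needed to
    isolate one coefficient of a polynomial from its values at the n-th roots of
    unity. *)
Lemma sum_prim_root_shift {F : fieldType} {n} {w : F} (i j : 'I_n) :
  n.-primitive_root w ->
  \sum_(k < n) (w ^+ i / w ^+ j) ^+ k = (n * (i == j))%:R.
Proof.
move=> w_prim; have n_gt0 := prim_order_gt0 w_prim.
have wX_neq0 m : w ^+ m != 0 by rewrite expf_neq0// (prim_root_eq0 w_prim) -lt0n.
have [<-|i_neq_j] := eqVneq i j.
  under eq_bigr do rewrite divff// expr1n.
  by rewrite sumr_const card_ord muln1.
have x_neq1 : w ^+ i / w ^+ j - 1 != 0.
  rewrite subr_eq0; apply: contraNneq i_neq_j => x1.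
  have /eqP : w ^+ i = w ^+ j by rewrite -[LHS](divfK (wX_neq0 j)) x1 mul1r.
  by rewrite (eq_prim_root_expr w_prim) !modn_small// => /eqP/val_inj ->.
apply: (mulfI x_neq1); rewrite -subrX1 muln0 mulr0.
by rewrite exprMn exprVn -!exprM ![(_ * n)%N]mulnC !exprM
  (prim_expr_order w_prim) !expr1n divr1 subrr.
Qed.

(** Averaging the values on the circle of radius r over n-th roots of unity, a
    discrete form of the Cauchy integral formula, gives the j-th coefficient
    exactly since the polynomial has degree less than n. *)
Lemma seminorm_Cauchy_estimate {R : realType} {A : lmodType R[i]}
    (q : seminorm A) n (c : nat -> A) (r B : R) (j : 'I_n) :
  0 <= r ->
  (forall z, normc z = r -> q (\sum_(i < n) z ^+ i *: c i) <= B) ->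
  r ^+ j * q (c j) <= B.
Proof.
move=> r_ge0 qB; have n_gt0 : (0 < n)%N by exact: leq_ltn_trans (ltn_ord j).
have [w w_prim] := prim_root_exists R[i] n_gt0.
have w1 : normc w = 1.
  apply/eqP; rewrite -(pexpr_eq1 n_gt0 (normc_ge0 w)) -normcX.
  by rewrite (prim_expr_order w_prim) ComplexField.Normc.normc1.
pose z k := r%:C * w ^+ k.
have z_norm k : normc (z k) = r.
  by rewrite ComplexField.Normc.normcM normcX w1 expr1n mulr1 normc_real ger0_norm.
pose S := \sum_(k < n) (w ^+ j) ^- k *: \sum_(i < n) z k ^+ i *: c i.
have SE : S = (n%:R * r%:C ^+ j) *: c j.
  transitivity (\sum_(i < n) (r%:C ^+ i *
      (\sum_(k < n) (w ^+ i / w ^+ j) ^+ k)) *: c i).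
    rewrite /S; under eq_bigr do rewrite scaler_sumr.
    rewrite exchange_big /=; apply: eq_bigr => i _.
    rewrite mulr_sumr scaler_suml; apply: eq_bigr => k _; rewrite scalerA.
    congr (_ *: _); rewrite /z exprMn expr_div_n -!exprM [(k * i)%N]mulnC.
    by rewrite mulrC -mulrA.
  rewrite (bigD1 j)//= sum_prim_root_shift// eqxx muln1 mulrC.
  rewrite -[RHS]addr0; congr (_ + _); apply: big1 => i i_neq_j.
  by rewrite sum_prim_root_shift// (negbTE i_neq_j) muln0 mulr0 scale0r.
have S_le : q S <= n%:R * B.
  rewrite (le_trans (seminorm_sum q n
    (fun k => (w ^+ j) ^- k *: \sum_(i < n) z k ^+ i *: c i)))//.
  rewrite mulr_natl -[leRHS](_ : \sum_(k < n) B = _); last first.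
    by rewrite sumr_const card_ord.
  apply: ler_sum => k _; rewrite seminormZ ComplexField.Normc.normcV !normcX w1.
  by rewrite !expr1n invr1 mul1r qB.
rewrite -(ler_pM2l (_ : 0 < n%:R :> R)) ?ltr0n//; apply: le_trans S_le.
rewrite SE seminormZ ComplexField.Normc.normcM normcX normc_real ger0_norm//.
by rewrite -(@rmorph_nat _ _ (real_complex R)) normc_real ger0_norm// mulrA.
Qed.

(** * Operators whose shifts grow quadratically *)

(** The binomial expansion of the n-th power of 1 + z T, of which only the linear
    coefficient matters. *)
Lemma iter_shift_expand {F : comNzRingType} {A : lmodType F} (T : {linear A -> A})
    (b : A) n : exists2 c : nat -> A, c 1%N = n%:R *: T b &
  forall z, iter n (fun x => x + z *: T x) b = \sum_(i < n.+2) z ^+ i *: c i.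
Proof.
(* The linear coefficient at step n + 1 involves the constant one at step n. *)
suff [c [_ c1 cE]] : exists c : nat -> A, [/\ c 0%N = b, c 1%N = n%:R *: T b &
  forall z, iter n (fun x => x + z *: T x) b = \sum_(i < n.+2) z ^+ i *: c i].
  by exists c.
elim: n => [|n [c [c0 c1 cE]]].
  exists (fun i => if i is 0 then b else 0); split=> //; first by rewrite scale0r.
  by move=> z /=; rewrite !big_ord_recl big_ord0 /= !scaler0 !addr0 expr0 scale1r.
pose d i := (if (i < n.+2)%N then c i else 0) +
            (if i is i'.+1 then T (c i') else 0).
exists d; split; first by rewrite /d /= addr0.
  by rewrite /d /= c1 c0 -[X in _ + X]scale1r -scalerDl natr1.
move=> z; rewrite iterS cE /d.
under [RHS]eq_bigr do rewrite scalerDr.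
rewrite big_split /=; congr (_ + _).
  rewrite [RHS]big_ord_recr /= ltnn scaler0 addr0.
  by apply: eq_bigr => i _; rewrite ltn_ord.
rewrite [RHS]big_ord_recl scaler0 add0r linear_sum scaler_sumr.
by apply: eq_bigr => i _; rewrite linearZ /= scalerA exprS.
Qed.

(** An operator with numerical range {0}, in the sense that 1 + z T has norm
    1 + O(|z|^2) in all complex directions z, is zero.  Real directions alone
    would not do: a rotation generator is a counterexample. *)
Lemma shift_growth_eq0 {R : realType} {A : lmodType R[i]} (q : seminorm A)
    (T : {linear A -> A}) (C : R) :
  0 <= C ->
  (forall z b, q (b + z *: T b) <= (1 + C * normc z ^+ 2) * q b) ->
  forall b, q (T b) = 0.
Proof.
move=> C_ge0 shift_le b.
have iter_le n z : q (iter n (fun x => x + z *: T x) b) <=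
    (1 + C * normc z ^+ 2) ^+ n * q b.
  elim: n => [|n IHn]; first by rewrite expr0 mul1r.
  rewrite iterS (le_trans (shift_le _ _))// (exprS _ n) -mulrA ler_wpM2l//.
  by rewrite addr_ge0// mulr_ge0// sqr_ge0.
(* Radius 1 / (m + 1) and exponent (m + 1)^2 balance the Cauchy estimate: the
   bound on the circle stays below e^C. *)
have linear_growth m : m.+1%:R * q (T b) <= expR C * q b.
  set s : R := m.+1%:R; have s_gt0 : 0 < s by rewrite ltr0n.
  have [c c1 cE] := iter_shift_expand T b (m.+1 ^ 2).
  have sV_ge0 : 0 <= s^-1 by rewrite invr_ge0 ltW.
  have /= := @seminorm_Cauchy_estimate R A q (m.+1 ^ 2).+2 c s^-1
    (expR C * q b) (lift ord0 ord0) sV_ge0.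
  have -> : bump 0 0 = 1%N by [].
  rewrite c1 seminormZ_nat natrX -/s expr1 mulrA expr2 mulKf ?gt_eqF//; apply.
  move=> z z_norm; rewrite -cE (le_trans (iter_le _ _))//.
  rewrite ler_wpM2r ?seminorm_ge0// z_norm.
  have -> : expR C = expR (C * s^-1 ^+ 2) ^+ (m.+1 ^ 2).
    by rewrite -expRM_natl natrX -/s mulrCA -exprMn divff ?gt_eqF// expr1n mulr1.
  by rewrite lerXn2r ?nnegrE ?expR_ge0 ?expR_ge1Dx// addr_ge0// mulr_ge0// sqr_ge0.
apply/eqP; rewrite eq_le seminorm_ge0 andbT leNgt; apply/negP => q_gt0.
have := linear_growth (Num.bound (expR C * q b / q (T b))).
rewrite leNgt -ltr_pdivrMr//; apply/negP/negPn.
apply: lt_le_trans (archi_boundP _) _; last by rewrite ler_nat.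
by rewrite divr_ge0 ?mulr_ge0 ?expR_ge0 ?seminorm_ge0.
Qed.

(** * Involutions and C*-seminorms *)

Section Involution.
Context {R : realType} {A : lmodType R[i]} {mul : A -> A -> A} {star : A -> A}.
Hypothesis star_inv : is_involution mul star.

Lemma involutionD a b : star (a + b) = star a + star b.
Proof.
by have := involution_antilinear star_inv a b 1; rewrite !scale1r conjc1 scale1r.
Qed.

Lemma involution0 : star 0 = 0.
Proof. by apply: (addrI (star 0)); rewrite -involutionD !addr0. Qed.

Lemma involutionZ l a : star (l *: a) = conjc l *: star a.
Proof.
by rewrite -[l *: a]add0r (involution_antilinear star_inv) involution0 add0r.
Qed.

Lemma involutionN a : star (- a) = - star a.
Proof. by apply: (addrI (star a)); rewrite -involutionD !subrr involution0. Qed.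

Lemma involution_real_part a : star (a + star a) = a + star a.
Proof. by rewrite involutionD (involutionK star_inv) addrC. Qed.

End Involution.

Lemma le_of_sqr_le {R : realDomainType} (x k y : R) :
  0 <= x -> 0 <= y -> 1 <= k -> x ^+ 2 <= k * y ^+ 2 -> x <= k * y.
Proof.
move=> x_ge0 y_ge0 k_ge1 x2_le; have k_ge0 : 0 <= k by exact: le_trans k_ge1.
rewrite -(@ler_pXn2r _ 2) ?nnegrE ?mulr_ge0// exprMn (le_trans x2_le)//.
by rewrite ler_wpM2r ?sqr_ge0// expr2 ler_peMl.
Qed.

Section CstarSeminorm.
Context {R : realType} {A : lmodType R[i]} {mul : {bilinear A -> A -> A}}
  {star : A -> A} {q : seminorm A}.
Hypotheses (mulA : associative mul) (star_inv : is_involution mul star)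
  (star_q : is_Cstar_seminorm mul star q).

Lemma Cstar_involution_le a : q a <= q (star a).
Proof.
have [qa0|qa_neq0] := eqVneq (q a) 0; first by rewrite qa0 seminorm_ge0.
have qa_gt0 : 0 < q a by rewrite lt0r qa_neq0 seminorm_ge0.
rewrite -(ler_pM2r qa_gt0) -expr2 -(Cstar_identity star_q).
exact: Cstar_seminormM star_q _ _.
Qed.

Lemma Cstar_seminorm_involution a : q (star a) = q a.
Proof.
apply/eqP; rewrite eq_le Cstar_involution_le andbT.
by rewrite -[X in _ <= q X](involutionK star_inv) Cstar_involution_le.
Qed.

Lemma Cstar_seminorm_sandwich_le w b :
  q (mul (star b) (mul (mul w w) b)) <= q w ^+ 2 * q b ^+ 2.
Proof.
have -> : q w ^+ 2 * q b ^+ 2 = q (star b) * (q w * q w * q b).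
  by rewrite Cstar_seminorm_involution; ring.
apply: le_trans (Cstar_seminormM star_q _ _) _.
rewrite ler_wpM2l ?seminorm_ge0//.
apply: le_trans (Cstar_seminormM star_q _ _) _.
by rewrite ler_wpM2r ?seminorm_ge0// (Cstar_seminormM star_q).
Qed.

(** The operator form of |1 + w|^2 = |1 - w^2| for skew w: the terms linear in w
    cancel. *)
Lemma skew_shift_le {w} b :
  star w = - w -> q (b + mul w b) <= (1 + q w ^+ 2) * q b.
Proof.
move=> w_skew; apply: le_of_sqr_le; rewrite ?seminorm_ge0 ?lerDl ?sqr_ge0//.
rewrite -(Cstar_identity star_q (b + mul w b)).
rewrite (involutionD star_inv) (involutionM star_inv).
have -> : mul (star b + mul (star b) (star w)) (b + mul w b) =
    mul (star b) b - mul (star b) (mul (mul w w) b).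
  rewrite w_skew linearNr linearDl !linearDr !linearNl /= !mulA.
  by rewrite addrA addrK.
apply: le_trans (seminormD _ _ _) _; rewrite seminormN (Cstar_identity star_q).
rewrite mulrDl mul1r lerD2l.
exact: Cstar_seminorm_sandwich_le.
Qed.

(** For self-adjoint v the terms linear in v add up instead of cancelling; the
    hypothesis controls b^* (b + 2 v b), the part of (b + v b)^* (b + v b) of
    degree at most one in v. *)
Lemma selfadjoint_shift_le v b r :
  star v = v -> 0 <= r ->
  q (mul (star b) (b + 2 *: mul v b)) <= (1 + r) * q b ^+ 2 ->
  q (b + mul v b) <= (1 + (r + q v ^+ 2)) * q b.
Proof.
move=> v_selfadj r_ge0 re_le.
apply: le_of_sqr_le; rewrite ?seminorm_ge0 ?lerDl ?addr_ge0 ?sqr_ge0//.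
rewrite -(Cstar_identity star_q (b + mul v b)).
rewrite (involutionD star_inv) (involutionM star_inv).
have -> : mul (star b + mul (star b) (star v)) (b + mul v b) =
    mul (star b) (b + 2 *: mul v b) + mul (star b) (mul (mul v v) b).
  rewrite v_selfadj linearDl !linearDr linearZr /= scaler_nat mulr2n !mulA.
  by rewrite !addrA.
apply: le_trans (seminormD _ _ _) _; rewrite addrA mulrDl lerD//.
exact: Cstar_seminorm_sandwich_le.
Qed.

End CstarSeminorm.

(** * Comparing two involutions *)

Section TwoInvolutions.
Context {R : realType} {A : lmodType R[i]} {mul : {bilinear A -> A -> A}}
  {star sharp : A -> A} {q : seminorm A}.
Hypotheses (mulA : associative mul)
  (star_inv : is_involution mul star) (star_q : is_Cstar_seminorm mul star q)
  (sharp_inv : is_involution mul sharp)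
  (sharp_q : is_Cstar_seminorm mul sharp q).

(** This step carries information from one involution to the other: b + 4 u b
    has norm (1 + O(|u|^2)) q b because u is skew for star, and then its real
    part for sharp, taken after multiplying by sharp b on the left, is controlled
    because sharp is isometric. *)
Lemma sharp_real_part_shift_le {u} b :
  star u = - u ->
  q (b + mul (u + sharp u) b) <= (1 + 20 * q u ^+ 2) * q b.
Proof.
move=> u_skew; set v := u + sharp u.
have v_selfadj : sharp v = v by exact: involution_real_part sharp_inv u.
have v_le : q v ^+ 2 <= 4 * q u ^+ 2.
  have : q v <= q u + q u.
    apply: le_trans (seminormD _ _ _) _.
    by rewrite (Cstar_seminorm_involution sharp_inv sharp_q).
  have := seminorm_ge0 q v; have := seminorm_ge0 q u; nra.
have r_ge0 : 0 <= 16 * q u ^+ 2 by rewrite mulr_ge0// sqr_ge0.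
apply: (@le_trans _ _ ((1 + (16 * q u ^+ 2 + q v ^+ 2)) * q b)); last first.
  by rewrite ler_wpM2r ?seminorm_ge0//; lra.
apply: (selfadjoint_shift_le mulA sharp_inv sharp_q) => //.
(* The factor 4 makes the real part of (sharp b) y equal to
   (sharp b) (b + 2 v b). *)
pose y := b + mul (4 *: u) b.
have y_le : q y <= (1 + 16 * q u ^+ 2) * q b.
  have u4_skew : star (4 *: u) = - (4 *: u).
    by rewrite (involutionZ star_inv) conjc_nat u_skew scalerN.
  apply: le_trans (skew_shift_le mulA star_inv star_q b u4_skew) _.
  by rewrite seminormZ_nat exprMn -natrX.
have yE : 2 *: mul (sharp b) (b + 2 *: mul v b) =
    mul (sharp b) y + mul (sharp y) b.
  have -> : mul (sharp b) y = mul (sharp b) b + 4 *: mul (sharp b) (mul u b).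
    by rewrite /y linearDr linearZl /= linearZr.
  have -> : mul (sharp y) b =
      mul (sharp b) b + 4 *: mul (sharp b) (mul (sharp u) b).
    rewrite /y (involutionD sharp_inv) (involutionM sharp_inv).
    rewrite (involutionZ sharp_inv) conjc_nat linearDl linearZr linearZl /=.
    by rewrite mulA.
  rewrite linearDr linearZr /= linearDl linearDr /= !scalerDr !scalerA -natrM.
  by rewrite [2 *: _]scaler_nat mulr2n addrACA.
rewrite -(@ler_pM2l _ 2)// -seminormZ_nat yE.
apply: le_trans (seminormD _ _ _) _.
have := Cstar_seminormM sharp_q (sharp b) y.
have := Cstar_seminormM sharp_q (sharp y) b.
rewrite !(Cstar_seminorm_involution sharp_inv sharp_q).
have := seminorm_ge0 q b.
nra.
Qed.

(** A star-skew element has no real part for sharp: the shifts by its real part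
    grow quadratically in real directions by the previous lemma, and in imaginary
    ones by skewness for sharp. *)
Lemma sharp_real_part_eq0 u : star u = - u -> q (u + sharp u) = 0.
Proof.
move=> u_skew; set v := u + sharp u.
have v_selfadj : sharp v = v by exact: involution_real_part sharp_inv u.
have C_ge0 : 0 <= 40 * q u ^+ 2 + 2 * q v ^+ 2.
  by rewrite addr_ge0// mulr_ge0// sqr_ge0.
suff /(_ v) : forall b, q (mul v b) = 0.
  rewrite -{1}v_selfadj (Cstar_identity sharp_q) => /eqP.
  by rewrite sqrf_eq0 => /eqP.
(* The shift by z = x + i y is the mean of the shifts by 2 x and by 2 i y. *)
apply: (@shift_growth_eq0 _ _ q (mul v) _ C_ge0) => z b; case: z => x y.
have real_le : q (b + mul ((2 * x)%:C *: v) b) <=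
    (1 + 20 * (2 * x) ^+ 2 * q u ^+ 2) * q b.
  have xu_skew : star ((2 * x)%:C *: u) = - ((2 * x)%:C *: u).
    by rewrite (involutionZ star_inv) u_skew scalerN /= oppr0.
  have := sharp_real_part_shift_le b xu_skew.
  rewrite (involutionZ sharp_inv) /= oppr0 -scalerDr => /le_trans; apply.
  by rewrite seminormZ normc_real exprMn real_normK ?num_real// mulrA.
have imag_le : q (b + mul ((0 +i* (2 * y)) *: v) b) <=
    (1 + (2 * y) ^+ 2 * q v ^+ 2) * q b.
  have yv_skew : sharp ((0 +i* (2 * y)) *: v) = - ((0 +i* (2 * y)) *: v).
    rewrite (involutionZ sharp_inv) v_selfadj -scaleNr; congr (_ *: _).
    by apply/eqP; rewrite eq_complex /= oppr0 !eqxx.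
  have := skew_shift_le mulA sharp_inv sharp_q b yv_skew.
  by rewrite seminormZ normc_imaginary exprMn real_normK ?num_real.
have mean : 2 *: (b + (x +i* y) *: mul v b) =
    (b + mul ((2 * x)%:C *: v) b) + (b + mul ((0 +i* (2 * y)) *: v) b).
  rewrite !linearZl /= addrACA -scalerDl scalerDr scalerA scaler_nat mulr2n.
  congr (_ + _ *: _); apply/eqP; rewrite eq_complex /=.
  by apply/andP; split; apply/eqP; ring.
rewrite -(@ler_pM2l _ 2)// -seminormZ_nat mean.
apply: le_trans (seminormD _ _ _) _.
have -> : normc (x +i* y) ^+ 2 = x ^+ 2 + y ^+ 2.
  by rewrite /= sqr_sqrtr// addr_ge0// sqr_ge0.
apply: le_trans (lerD real_le imag_le) _.
rewrite -mulrDl [leRHS]mulrA ler_wpM2r ?seminorm_ge0//.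
have := sqr_ge0 x; have := sqr_ge0 y.
have := sqr_ge0 (q u); have := sqr_ge0 (q v).
nra.
Qed.

End TwoInvolutions.

(** Both star a - a and i (star a + a) are star-skew, hence sharp-skew, which
    gives the value of sharp at star a - a and at star a + a. *)
Lemma separating_Cstar_seminorms_involution_unique {R : realType}
    {A : lmodType R[i]} {mul : {bilinear A -> A -> A}} {L : Type}
    {p : L -> seminorm A} {star sharp : A -> A} :
  associative mul -> separating p ->
  is_involution mul star -> (forall i, is_Cstar_seminorm mul star (p i)) ->
  is_involution mul sharp -> (forall i, is_Cstar_seminorm mul sharp (p i)) ->
  forall a, star a = sharp a.
Proof.
move=> mulA p_sep star_inv star_p sharp_inv sharp_p.
have skew u : star u = - u -> sharp u = - u.
  move=> u_skew; apply/eqP; rewrite -addr_eq0 addrC; apply/eqP/p_sep => i.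
  exact: (sharp_real_part_eq0 mulA star_inv (star_p i) sharp_inv (sharp_p i)).
move=> a.
have diff : sharp (star a - a) = a - star a.
  rewrite skew ?opprB// (involutionD star_inv) (involutionN star_inv).
  by rewrite (involutionK star_inv).
have sum : sharp (star a + a) = star a + a.
  have i_neq0 : 'i%C != 0 :> R[i] by rewrite eq_complex /= oner_eq0 andbF.
  apply: (@scalerI _ _ ('i%C : R[i])) => //; apply: oppr_inj.
  rewrite -[LHS]scaleNr (_ : - 'i%C = conjc 'i%C); last first.
    by apply/eqP; rewrite eq_complex /= oppr0 !eqxx.
  rewrite -(involutionZ sharp_inv) skew// (involutionZ star_inv).
  rewrite (involutionD star_inv) (involutionK star_inv) addrC -scaleNr.
  by congr (_ *: _); apply/eqP; rewrite eq_complex /= oppr0 !eqxx.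
apply/esym/(@scalerI _ _ (2 : R[i])); first by rewrite pnatr_eq0.
rewrite !scaler_nat !mulr2n -(involutionD sharp_inv).
rewrite -[a + a](_ : star a + a - (star a - a) = _); last first.
  by rewrite opprB addrC subrKA.
rewrite (involutionD sharp_inv) (involutionN sharp_inv) sum diff.
by rewrite opprB addrC [X in _ + X]addrC subrKA.
Qed.

Theorem theorem2 (R : realType) (A : lmodType R[i])
    (mul : {bilinear A -> A -> A}) (mulA : associative mul)
    (L : Type) (p : L -> seminorm A) (star sharp : A -> A)
    (hstar : is_locally_Cstar mul star p)
    (hsharp : is_locally_Cstar mul sharp p) :
  forall a : A, star a = sharp a.
Proof.
apply: (separating_Cstar_seminorms_involution_unique mulA
  (locally_Cstar_separating hstar)).
(* The topological module underlying the definition has A as its carrier but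
   is another structure on it, so the fields are repackaged one by one. *)
- by case: (star_algebra_involution (locally_Cstar_topological hstar)).
- exact: locally_Cstar_seminorm hstar.
- by case: (star_algebra_involution (locally_Cstar_topological hsharp)).
- exact: locally_Cstar_seminorm hsharp.
Qed.
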